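(* For any finitely generated abelian group $A$, the space $\mathrm{CO}_{\mathrm{rot}}(A)$ of rotation orders of $A$ is dense in the space $\mathrm{CO}(A)$ of all left-invariant circular orders on $A$.
   Context: A left-invariant circular order on a group $G$ is a map $\phi:G^3\to\{-1,0,1\}$ such that: (DV) $\phi(x,y,z)=0$ if and only if at least two of $x,y,z$ are equal; (C) $\phi(g_1,g_2,g_3)-\phi(g_0,g_2,g_3)+\phi(g_0,g_1,g_3)-\phi(g_0,g_1,g_2)=0$ for all $g_0,\dots,g_3\in G$; (H) $\phi(gg_0,gg_1,gg_2)=\phi(g_0,g_1,g_2)$ for all $g,g_0,g_1,g_2\in G$. The set $\mathrm{CO}(G)$ of all left-invariant circular orders on $G$ has the subspace topology from $\{-1,0,1\}^{G^3}$ (product topology, $\{-1,0,1\}$ discrete). A rotation order of $A$ is a circular order having a dynamical realization that is an action of $A$ on $S^1=\mathbb{R}/\mathbb{Z}$ by rotations; explicitly, $c$ is a rotation order if there is an injective homomorphism $\rho:A\to\mathbb{R}/\mathbb{Z}$ such that for all $a,b,d\in A$, $c(a,b,d)$ is $+1$, $-1$ or $0$ according to whether $(\rho(a),\rho(b),\rho(d))$ is positively oriented, negatively oriented or degenerate (has a repeated entry) in $\mathbb{R}/\mathbb{Z}$. $\mathrm{CO}_{\mathrm{rot}}(A)\subset\mathrm{CO}(A)$ is the set of rotation orders. *)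

(* Defs.v *)
From HB Require Import structures.
From mathcomp Require Import all_boot all_order all_algebra.
From mathcomp Require Import boolp classical_sets functions reals topology.

Set Implicit Arguments.
Unset Strict Implicit.
Unset Printing Implicit Defensive.

Import Order.TTheory GRing.Theory Num.Theory.
Local Open Scope classical_set_scope.
Local Open Scope ring_scope.

Definition finitely_generated (A : zmodType) : Prop :=
  exists (m : nat) (s : m.-tuple A), forall a : A, inIntSpan s a.

Definition sign3 : Type := seq_sub [:: -1; 0; 1 : int].
HB.instance Definition _ := DiscreteTopology.copy sign3
  (discrete_topology (seq_sub [:: -1; 0; 1 : int])).

Definition sign3_int (s : sign3) : int := ssval s.
Coercion sign3_int : sign3 >-> int.

Definition ternary (A : zmodType) : Type := {ptws A * A * A -> sign3}.
HB.instance Definition _ (A : zmodType) :=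
  Topological.copy (ternary A) {ptws A * A * A -> sign3}.

(* CO A is used both as a set and, through the coercion to set_type, as a type
   carrying the subspace topology. The group law of A is written additively. *)
Definition CO (A : zmodType) : set (ternary A) :=
  [set phi |
    [/\ forall x y z : A,
          phi (x, y, z) = 0 :> int <-> (x = y \/ y = z \/ x = z),
        forall g0 g1 g2 g3 : A,
          (phi (g1, g2, g3) : int) - (phi (g0, g2, g3) : int)
          + (phi (g0, g1, g3) : int) - (phi (g0, g1, g2) : int) = 0
      & forall g g0 g1 g2 : A,
          phi (g + g0, g + g1, g + g2) = phi (g0, g1, g2)]].
Arguments CO : clear implicits.

(* The additive subgroup Z of R; Num.int_num_subdef is the predicate underlying
   Num.int, on which the library declares its subgroup structure. *)
Definition integers (R : realType) : zmodClosed R :=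
  GRing.ZmodClosed.clone R (@Num.int_num_subdef R) _.

Definition circle (R : realType) : Type := {ideal_quot (integers R)}.
HB.instance Definition _ (R : realType) :=
  GRing.Zmodule.copy (circle R) {ideal_quot (integers R)}.

Definition circle_pi (R : realType) (t : R) : circle R :=
  (\pi_{ideal_quot (integers R)} t)%qT.

(* Going once around R / Z in the increasing direction from x, one meets y and
   then z before coming back to x. *)
Definition positively_oriented (R : realType) (x y z : circle R) : Prop :=
  exists t u v : R,
    [/\ circle_pi t = x, circle_pi u = y, circle_pi v = z
      & [/\ t < u, u < v & v < t + 1]].

Definition negatively_oriented (R : realType) (x y z : circle R) : Prop :=
  exists t u v : R,
    [/\ circle_pi t = x, circle_pi u = y, circle_pi v = z
      & [/\ t - 1 < v, v < u & u < t]].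

Definition degenerate (R : realType) (x y z : circle R) : Prop :=
  x = y \/ y = z \/ x = z.

Definition CO_rot (R : realType) (A : zmodType) : set (ternary A) :=
  [set c | CO A c /\
    exists rho : {additive A -> circle R},
      injective rho /\
      forall a b d : A,
        [/\ c (a, b, d) = 1 :> int
              <-> positively_oriented (rho a) (rho b) (rho d),
            c (a, b, d) = -1 :> int
              <-> negatively_oriented (rho a) (rho b) (rho d)
          & c (a, b, d) = 0 :> int
              <-> degenerate (rho a) (rho b) (rho d)]].
Arguments CO_rot : clear implicits.

(* Main.v *)
Require Import Defs.
From HB Require Import structures.
From mathcomp Require Import all_boot all_order all_algebra.
From mathcomp Require Import boolp classical_sets functions reals topology.
From mathcomp Require Import cardinality ereal measure lebesgue_measure.
From mathcomp Require Import zify ring lra.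

(* A circular order c on A lifts to a total order on a central extension of A by
   Z, whose underlying set is Z x A; for A abelian the extension is abelian, since
   its commutator pairing is bilinear and takes values in {-1, 0, 1}. When A is
   finitely generated, so is this ordered group, and for any finite set of its
   positive elements there is an injective homomorphism to R which is positive on
   them: extend one generator at a time, by Fourier-Motzkin elimination, choosing
   the image of a new free generator in an open interval minus a countable set.
   Normalising so that the generator of Z goes to 1 and passing to the quotient
   gives an injective homomorphism A -> R / Z inducing a rotation order that
   agrees with c on any prescribed finite set of triples. *)

Set Implicit Arguments.
Unset Strict Implicit.
Unset Printing Implicit Defensive.

Import Order.TTheory GRing.Theory Num.Theory.
Local Open Scope classical_set_scope.
Local Open Scope ring_scope.

(** * Real embeddings of finitely generated ordered abelian groups *)

(** The one-sided separation [sup] is used twice: once to find [lo], then, after negation, to find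
    [hi] strictly above it. A nondegenerate interval is needed, so that a countable set can later be
    avoided inside it; either list may be empty. *)
Lemma finite_separation (R : realType) (l u : seq R) :
  (forall a b, a \in l -> b \in u -> a < b) ->
  exists lo hi, [/\ lo < hi, forall a, a \in l -> a <= lo
    & forall b, b \in u -> hi <= b].
Proof.
have sup (l' u' : seq R) : (forall a b, a \in l' -> b \in u' -> a < b) ->
    exists m, (forall a, a \in l' -> a <= m) /\ (forall b, b \in u' -> m < b).
  elim: l' => [_|a l' IH lu].
    elim: u' => [|b u' [m [_ IH]]]; first by exists 0.
    exists (Num.min m (b - 1)); split=> // b'; rewrite inE gt_min.
    by case/orP=> [/eqP->|/IH->//]; apply/orP; right; rewrite gtrBl.
  have [|m [lm mu]] := IH.
    by move=> a' b a'l bu; apply: lu => //; rewrite inE a'l orbT.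
  exists (Num.max m a); split=> [a'|b bu]; rewrite ?inE.
    by rewrite le_max; case/orP=> [/eqP->|/lm->//]; rewrite lexx orbT.
  by rewrite gt_max mu // lu // inE eqxx.
move=> lu; have [lo [llo lou]] := sup _ _ lu.
have [|m [mu mlo]] := sup [seq - b | b <- u] [:: - lo].
  move=> b' a' /mapP[b bu ->]; rewrite inE => /eqP->.
  by rewrite ltrN2 lou.
exists lo, (- m); split=> //; first by rewrite ltrNr mlo ?inE.
by move=> b bu; rewrite lerNl mu // map_f.
Qed.

(** Otherwise the interval would be countable, hence Lebesgue null, against its positive length. *)
Lemma countable_avoid (R : realType) (B : set R) (lo hi : R) :
  countable B -> lo < hi -> exists v, [/\ lo < v, v < hi & ~ B v].
Proof.
move=> cB lohi; apply: contrapT => nov.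
have sub : [set` `]lo, hi[] `<=` B.
  move=> v /=; rewrite in_itv /= => /andP[lov vhi].
  by apply: contrapT => nB; apply: nov; exists v.
have := countable_lebesgue_measure0 (sub_countable (subset_card_le sub) cB).
rewrite lebesgue_measure_itv /= lte_fin lohi -EFinB => /eqP.
by rewrite eqe subr_eq0 => /eqP hl; rewrite hl ltxx in lohi.
Qed.

(** The recursion peels off one generator at a time, to match the induction in
    [ordered_group_embed]. *)
Fixpoint zspan (G : zmodType) (s : seq G) (x : G) : Prop :=
  if s is g :: s' then exists k : int, zspan s' (x - g *~ k) else x = 0.

Lemma zspan0 (G : zmodType) (s : seq G) : zspan s 0.
Proof. by elim: s => //= g s IH; exists 0; rewrite mulr0z subr0. Qed.

Lemma zspanD (G : zmodType) (s : seq G) (x y : G) :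
  zspan s x -> zspan s y -> zspan s (x + y).
Proof.
elim: s x y => [|g s IH] x y /=; first by move=> -> ->; rewrite addr0.
move=> [k xk] [j yj]; exists (k + j).
by rewrite mulrzDr opprD addrACA; apply: IH.
Qed.

Lemma zspanN (G : zmodType) (s : seq G) (x : G) : zspan s x -> zspan s (- x).
Proof.
elim: s x => [|g s IH] x /=; first by move=> ->; rewrite oppr0.
by move=> [k xk]; exists (- k); rewrite mulrNz -opprD; apply: IH.
Qed.

Lemma zspanMz (G : zmodType) (s : seq G) (x : G) (k : int) :
  zspan s x -> zspan s (x *~ k).
Proof.
move=> sx; have nat n : zspan s (x *+ n).
  by elim: n => [|n IH]; rewrite ?mulr0n ?mulrS; [exact: zspan0|exact: zspanD].
by case: k => n; [exact: nat|apply: zspanN; exact: nat].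
Qed.

Lemma zspan_sub (G : zmodType) (g : G) (s : seq G) (x : G) :
  zspan s x -> zspan (g :: s) x.
Proof. by move=> sx; exists 0; rewrite mulr0z subr0. Qed.

Lemma zspan_mem (G : zmodType) (s : seq G) (x : G) : x \in s -> zspan s x.
Proof.
elim: s => //= g s IH; rewrite inE => /orP[/eqP->|/IH]; last exact: zspan_sub.
by exists 1; rewrite mulr1z subrr; apply: zspan0.
Qed.

Definition additive_on (G : zmodType) (V : zmodType) (H : G -> Prop) (f : G -> V) :=
  forall x y, H x -> H y -> f (x + y) = f x + f y.

Lemma additive_on0 (G V : zmodType) (s : seq G) (f : G -> V) :
  additive_on (zspan s) f -> f 0 = 0.
Proof.
move=> fD; have := fD 0 0 (zspan0 s) (zspan0 s).
by rewrite addr0 => /esym/(canRL (addrK _)); rewrite subrr.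
Qed.

Lemma additive_onN (G V : zmodType) (s : seq G) (f : G -> V) x :
  additive_on (zspan s) f -> zspan s x -> f (- x) = - f x.
Proof.
move=> fD sx; apply/eqP; rewrite -addr_eq0 -fD //; last exact: zspanN.
by rewrite addNr (additive_on0 fD).
Qed.

Lemma additive_onMz (G V : zmodType) (s : seq G) (f : G -> V) x (k : int) :
  additive_on (zspan s) f -> zspan s x -> f (x *~ k) = f x *~ k.
Proof.
move=> fD sx; have nat n : f (x *+ n) = f x *+ n.
  elim: n => [|n IH]; first by rewrite !mulr0n (additive_on0 fD).
  by rewrite !mulrS fD ?IH //; apply: (zspanMz n%:Z).
case: k => n; first exact: nat.
by rewrite !NegzE !mulrNz (additive_onN fD) ?nat //; apply: zspanMz.
Qed.

Definition order_cone (G : zmodType) (P : G -> Prop) : Prop :=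
  [/\ forall x y, P x -> P y -> P (x + y), forall x, P x \/ P (- x)
    & forall x, P x -> P (- x) -> x = 0].

Definition strict (G : zmodType) (P : G -> Prop) (x : G) : Prop := P x /\ x <> 0.

Lemma strictD (G : zmodType) (P : G -> Prop) (x y : G) :
  order_cone P -> strict P x -> strict P y -> strict P (x + y).
Proof.
move=> [PD _ PN] [Px x0] [Py y0]; split; first exact: PD.
by move=> xy; apply: x0; apply: PN => //; rewrite (addr0_eq xy).
Qed.

Lemma strictMz (G : zmodType) (P : G -> Prop) (x : G) (k : int) :
  order_cone P -> 0 < k -> strict P x -> strict P (x *~ k).
Proof.
move=> cP; case: k => [[|n]|//] // _ Px; rewrite -pmulrn.
elim: n => [|n IH]; first by rewrite mulr1n.
by rewrite mulrS; apply: strictD.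
Qed.

(** Either [x] or [- x] would be strictly positive, and then so would its positive multiples. *)
Lemma order_cone_torsion_free (G : zmodType) (P : G -> Prop) (x : G) (k : int) :
  order_cone P -> k != 0 -> x *~ k = 0 -> x = 0.
Proof.
move=> cP k0 xk; apply: contrapT => x0; have [_ tot _] := cP.
wlog kpos : k k0 xk / 0 < k.
  move=> hw; have [kN|kP|k0'] := ltrgtP k 0; last by rewrite k0' in k0.
    by apply: (hw (- k)); rewrite ?oppr_eq0 ?oppr_gt0 // mulrNz xk oppr0.
  exact: hw xk kP.
have [Px|Px] := tot x.
  by have [] := strictMz cP kpos (conj Px x0).
have xN0 : - x <> 0 by move/eqP; rewrite oppr_eq0 => /eqP.
by have [_] := strictMz cP kpos (conj Px xN0); rewrite mulNrz xk oppr0.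
Qed.

(** Multiplication by [k] sends the larger span into the smaller one, so the extension is forced to
    be [f (x *~ k) / k]. It is injective because an ordered group is torsion free. *)
Lemma embed_extend_torsion (R : realType) (G : zmodType) (P : G -> Prop) (g : G)
    (s L : seq G) (k : int) (f : G -> R) :
  order_cone P -> 0 < k -> zspan s (g *~ k) ->
  additive_on (zspan s) f -> (forall x, zspan s x -> f x = 0 -> x = 0) ->
  (forall x, x \in [seq y *~ k | y <- L] -> zspan s x -> strict P x -> 0 < f x) ->
  exists h : G -> R, [/\ additive_on (zspan (g :: s)) h,
    forall x, zspan (g :: s) x -> h x = 0 -> x = 0
    & forall x, x \in L -> zspan (g :: s) x -> strict P x -> 0 < h x].
Proof.
move=> cP kpos sgk fD f0 fL.
have k0 : k != 0 by rewrite gt_eqF.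
have kR : 0 < k%:~R :> R by rewrite ltr0z.
have sk x : zspan (g :: s) x -> zspan s (x *~ k).
  move=> [j sj]; rewrite -[x](subrK (g *~ j)) mulrzDl mulrzAC.
  by apply: zspanD; apply: zspanMz.
exists (fun x => f (x *~ k) / k%:~R); split.
- by move=> x y /sk sx /sk sy; rewrite mulrzDl fD // mulrDl.
- move=> x /sk sx /eqP; rewrite mulf_eq0 invr_eq0 (gt_eqF kR) orbF => /eqP /(f0 _ sx).
  exact: order_cone_torsion_free cP k0.
- move=> x xL /sk sx Px; rewrite divr_gt0 // fL //; first exact: map_f.
  exact: strictMz.
Qed.

(** The extension is determined by the value [v] of [g]. Positivity on [L] bounds [v] by finitely
    many inequalities, and injectivity excludes countably many values. The bounds are compatible
    once [f] is positive on suitable combinations of elements of [L], hence the hypothesis for every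
    [L']. *)
Lemma embed_extend_free (R : realType) (G : zmodType) (P : G -> Prop) (g : G)
    (s L : seq G) :
  order_cone P -> countable [set: G] ->
  (forall k : int, zspan s (g *~ k) -> k = 0) ->
  (forall L' : seq G, exists f : G -> R, [/\ additive_on (zspan s) f,
     forall x, zspan s x -> f x = 0 -> x = 0
     & forall x, x \in L' -> zspan s x -> strict P x -> 0 < f x]) ->
  exists h : G -> R, [/\ additive_on (zspan (g :: s)) h,
    forall x, zspan (g :: s) x -> h x = 0 -> x = 0
    & forall x, x \in L -> zspan (g :: s) x -> strict P x -> 0 < h x].
Proof.
move=> cP cG free IH.
(* [kk x] is the coefficient of [g] in [x], and [hh x] below is the remainder in the span of [s];
   off the larger span [kk] is arbitrary. *)
have [kk kkP] : exists kk : G -> int,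
    forall x, zspan (g :: s) x -> zspan s (x - g *~ kk x).
  suff /choice[kk kkP] : forall x, exists k, zspan (g :: s) x -> zspan s (x - g *~ k).
    by exists kk.
  move=> x; have [[k sk]|nx] := pselect (zspan (g :: s) x); first by exists k.
  by exists 0 => /nx.
pose hh x := x - g *~ kk x.
have kkU x k : zspan s (x - g *~ k) -> kk x = k.
  move=> sk; apply/eqP; rewrite eq_sym -subr_eq0; apply/eqP; apply: free.
  have /zspanN := sk; have /kkP sx : zspan (g :: s) x by exists k.
  move=> /zspanD/(_ sx); rewrite opprB addrA subrK mulrzBr.
  exact.
have kkD x y : zspan (g :: s) x -> zspan (g :: s) y -> kk (x + y) = kk x + kk y.
  move=> /kkP sx /kkP sy; apply: kkU.
  by rewrite mulrzDr opprD addrACA; apply: zspanD.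
(* Fourier-Motzkin: eliminate g between an element where it has a positive
   coefficient and one where it has a negative coefficient. *)
pose elim x y := hh x *~ (- kk y) + hh y *~ kk x.
have elimE x y : elim x y = x *~ (- kk y) + y *~ kk x.
  rewrite /elim /hh !mulrzBl -!mulrzA mulrN [kk y * _]mulrC !mulrNz opprK.
  by rewrite addrACA subrr addr0.
(* The [hh x] serve the elements in which [g] has coefficient 0, the [elim x y] the compatibility of
   the bounds. *)
have [f [fD f0 fL]] := IH ([seq hh x | x <- L] ++ [seq elim x y | x <- L, y <- L]).
pose good x := zspan (g :: s) x /\ strict P x.
(* Solving [f (hh x) + kk x * v > 0] for [v] gives a lower or an upper bound according to the sign
   of [kk x]. *)
pose lows := [seq - f (hh x) / (kk x)%:~R | x <- L & `[< good x >] && (0 < kk x)].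
pose ups := [seq - f (hh x) / (kk x)%:~R | x <- L & `[< good x >] && (kk x < 0)].
have [|lo [hi [lohi lowsP upsP]]] := @finite_separation R lows ups.
  move=> a' b' /mapP[x]; rewrite mem_filter => /andP[/andP[/asboolP[sx Px] kx] xL] ->.
  move=> /mapP[y]; rewrite mem_filter => /andP[/andP[/asboolP[sy Py] ky] yL] ->.
  have /kkP shx := sx; have /kkP shy := sy.
  have : 0 < f (elim x y).
    apply: fL.
    - by rewrite mem_cat; apply/orP; right; apply/allpairsP; exists (x, y).
    - by apply: zspanD; apply: zspanMz.
    - by rewrite elimE; apply: strictD => //; apply: strictMz => //; rewrite oppr_gt0.
  rewrite fD; [|exact: zspanMz..].
  rewrite (additive_onMz _ fD shx) (additive_onMz _ fD shy) mulrNz.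
  rewrite -[f (hh x) *~ _]mulrzr -[f (hh y) *~ _]mulrzr.
  have : 0 < (kk x)%:~R :> R by rewrite ltr0z.
  have : (kk y)%:~R < 0 :> R by rewrite ltrz0.
  move: (f _) (f _) (_%:~R) (_%:~R) => a b p q p0 q0 h.
  rewrite ltr_pdivrMr // mulrAC ltr_ndivlMr //; lra.
(* The values of [v] to avoid are those that would send some element with a nonzero coefficient of
   [g] to 0. *)
have [|v [lov vhi vB]] := @countable_avoid R
    (range (fun xk : G * int => - f xk.1 / xk.2%:~R)) lo hi _ lohi.
  apply: sub_countable (card_image_le _ _) _.
  by rewrite -setXTT; apply: countableX.
exists (fun x => f (hh x) + (kk x)%:~R * v); split.
- move=> x y sx sy; rewrite kkD // intrD mulrDl addrACA -fD; try exact: kkP.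
  by rewrite /hh kkD // mulrzDr opprD addrACA.
- move=> x sx; have [k0|k0] := eqVneq (kk x) 0.
    by rewrite /hh k0 mulr0z subr0 mul0r addr0; apply: f0; have := kkP _ sx;
      rewrite k0 mulr0z subr0.
  move=> /eqP; rewrite addr_eq0 => /eqP fx; exfalso.
  apply: vB; exists (hh x, kk x) => //=.
  by rewrite fx opprK mulrAC divff ?mul1r // intr_eq0.
- move=> x xL sx Px; have [kN|kP|k0] := ltrgtP (kk x) 0.
  + have kR : (kk x)%:~R < 0 :> R by rewrite ltrz0.
    have : v < - f (hh x) / (kk x)%:~R.
      apply: lt_le_trans vhi _; apply: upsP; apply/mapP; exists x => //.
      by rewrite mem_filter xL kN !andbT; apply/asboolP.
    by rewrite ltr_ndivlMr // => ?; lra.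
  + have kR : 0 < (kk x)%:~R :> R by rewrite ltr0z.
    have : - f (hh x) / (kk x)%:~R < v.
      apply: le_lt_trans lov; apply: lowsP; apply/mapP; exists x => //.
      by rewrite mem_filter xL kP !andbT; apply/asboolP.
    by rewrite ltr_pdivrMr // => ?; lra.
  + rewrite k0 mul0r addr0; apply: fL; first by rewrite mem_cat map_f.
      exact: kkP.
    by rewrite /hh k0 mulr0z subr0.
Qed.

(** The order may be non-Archimedean, so positivity can be kept only on a finite list. The extension
    steps change that list, so the induction on [s] is for all [L]. *)
Lemma ordered_group_embed (R : realType) (G : zmodType) (P : G -> Prop) (s L : seq G) :
  order_cone P -> countable [set: G] ->
  exists f : G -> R, [/\ additive_on (zspan s) f,
    forall x, zspan s x -> f x = 0 -> x = 0
    & forall x, x \in L -> zspan s x -> strict P x -> 0 < f x].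
Proof.
move=> cP cG; elim: s L => [|g s IH] L.
  exists (fun=> 0); split=> [x y _ _|x|x _]; rewrite ?addr0 //=.
  by move=> -> [_].
have [[k [k0 sk]]|tors] := pselect (exists k : int, k != 0 /\ zspan s (g *~ k)).
  have [m [m0 sm]] : exists m : int, 0 < m /\ zspan s (g *~ m).
    have [kN|kP|k0'] := ltrgtP k 0; last by rewrite k0' in k0.
      by exists (- k); rewrite oppr_gt0 mulrNz; split=> //; apply: zspanN.
    by exists k.
  have [f [fD f0 fL]] := IH [seq y *~ m | y <- L].
  exact: embed_extend_torsion fL.
apply: (embed_extend_free L cP cG _ IH) => k sk; apply: contrapT => k0.
by apply: tors; exists k; split=> //; apply/eqP.
Qed.

(** * The central extension of a circular order *)

Definition co (A : zmodType) (c : CO A) (x y z : A) : int := set_val c (x, y, z).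

Lemma co0P (A : zmodType) (c : CO A) x y z :
  co c x y z = 0 <-> (x = y \/ y = z \/ x = z).
Proof. by have [+ _ _] := set_valP c; apply. Qed.

Lemma co_cocycle (A : zmodType) (c : CO A) g0 g1 g2 g3 :
  co c g1 g2 g3 - co c g0 g2 g3 + co c g0 g1 g3 - co c g0 g1 g2 = 0.
Proof. by have [_ + _] := set_valP c; apply. Qed.

Lemma coH (A : zmodType) (c : CO A) g x y z :
  co c (g + x) (g + y) (g + z) = co c x y z.
Proof. by rewrite /co; have [_ _ ->] := set_valP c. Qed.

Lemma sign3P (s : sign3) : [\/ (s : int) = -1, (s : int) = 0 | (s : int) = 1].
Proof.
case: s => i /=; rewrite !inE => /or3P[] /eqP ->.
- by constructor 1.
- by constructor 2.
- by constructor 3.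
Qed.

(** In the cocycle identity at [x, y, z, y] two of the four terms are degenerate. *)
Lemma co_swap23 (A : zmodType) (c : CO A) x y z : co c x z y = - co c x y z.
Proof.
have := co_cocycle c x y z y.
have -> : co c y z y = 0 by apply/co0P; auto.
have -> : co c x y y = 0 by apply/co0P; auto.
lia.
Qed.

Lemma co_diff (A : zmodType) (c : CO A) x y z : co c x y z = co c 0 (y - x) (z - x).
Proof. by rewrite -[RHS](coH c x) addr0 !subrKC. Qed.

(* [carry c a b] is 1 when, going around the circle from 0 by a and then by b,
   one reaches or passes 0 again: the Euler cocycle of c. *)
Definition carry (A : zmodType) (c : CO A) (a b : A) : int :=
  [&& a != 0, b != 0 & co c 0 a (a + b) != 1].

Lemma carry01 (A : zmodType) (c : CO A) (a b : A) :
  carry c a b = 0 \/ carry c a b = 1.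
Proof. by rewrite /carry; case: andb; [right|left]. Qed.

(* Twice the carry is cohomologous to -c, hence is a cocycle. *)
Lemma carryE (A : zmodType) (c : CO A) (a b : A) :
  2 * carry c a b =
    (a != 0 : int) + (b != 0 : int) - (a + b != 0 : int) - co c 0 a (a + b).
Proof.
rewrite /carry; have [->|a0] := eqVneq a 0.
  have -> : co c 0 0 (0 + b) = 0 by apply/co0P; auto.
  by rewrite !add0r; case: eqP.
have [->|b0] := eqVneq b 0.
  have -> : co c 0 a (a + 0) = 0 by apply/co0P; rewrite addr0; auto.
  by rewrite !addr0 a0.
have [ab|ab0] := eqVneq (a + b) 0.
  by rewrite ab; have -> : co c 0 a 0 = 0 by apply/co0P; auto.
have := sign3P (set_val c (0, a, a + b)); rewrite -/(co c 0 a (a + b)).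
have : co c 0 a (a + b) <> 0.
  move=> /co0P[/esym/eqP|[/eqP|/esym/eqP]]; rewrite ?(negbTE a0) ?(negbTE ab0) //.
  by rewrite -{1}[a]addr0 (inj_eq (addrI _)) eq_sym (negbTE b0).
by move=> ? [] //= ->.
Qed.

Lemma carryA (A : zmodType) (c : CO A) (a b d : A) :
  carry c a b + carry c (a + b) d = carry c b d + carry c a (b + d).
Proof.
(* The one face without 0 is brought back to 0 by translation by [a]. *)
have := co_cocycle c 0 a (a + b) (a + b + d).
have := coH c a 0 b (b + d); rewrite addr0 addrA.
have := carryE c a b; have := carryE c (a + b) d.
have := carryE c b d; have := carryE c a (b + d); rewrite addrA.
do !move: (Posz (nat_of_bool _)) => ?.
do !move: (co _ _ _ _) => ?; do !move: (carry _ _ _) => ?; lia.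
Qed.

(* The antisymmetrised carry is the commutator of the central extension: it is
   bilinear, and bounded by 1, so it vanishes. *)
Lemma carryC (A : zmodType) (c : CO A) (a b : A) : carry c a b = carry c b a.
Proof.
(* With [e a b := carry c a b - carry c b a], these three identities combine to
   [e (a + a) b = 2 * e a b]; both values of [e] lie in {-1, 0, 1}, so [e a b = 0]. *)
have h1 := carryA c a a b; have h2 := carryA c b a a; have h3 := carryA c a b a.
rewrite [b + a]addrC in h2 h3 *.
have := carry01 c a (a + b); have := carry01 c (a + b) a.
have := carry01 c (a + a) b; have := carry01 c b (a + a).
have := carry01 c a b; have := carry01 c b a.
move: h1 h2 h3; do !move: (carry _ _ _) => ?; lia.
Qed.

Lemma carry0r (A : zmodType) (c : CO A) a : carry c a 0 = 0.
Proof. by rewrite /carry eqxx andbF. Qed.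

Lemma carryNr (A : zmodType) (c : CO A) a : carry c a (- a) = (a != 0 : int).
Proof.
rewrite /carry oppr_eq0 subrr.
have -> : co c 0 a 0 = 0 by apply/co0P; auto.
by rewrite andbT andbb.
Qed.

(* The lift of c to the line: (n, a) stands for n turns followed by a, and (1, 0)
   is a full turn. *)
Definition co_cover (A : zmodType) (c : CO A) : Type := (int * A)%type.
HB.instance Definition _ (A : zmodType) (c : CO A) := Choice.on (co_cover c).

Definition cover_add (A : zmodType) (c : CO A) (x y : co_cover c) : co_cover c :=
  (x.1 + y.1 + carry c x.2 y.2, x.2 + y.2).

Definition cover_opp (A : zmodType) (c : CO A) (x : co_cover c) : co_cover c :=
  (- x.1 - (x.2 != 0 : int), - x.2).

Lemma cover_addA (A : zmodType) (c : CO A) : associative (@cover_add A c).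
Proof.
move=> [n a] [m b] [k d]; rewrite /cover_add /=; congr (_, _); last exact: addrA.
have := carryA c a b d; do !move: (carry _ _ _) => ?; lia.
Qed.

Lemma cover_addC (A : zmodType) (c : CO A) : commutative (@cover_add A c).
Proof.
by move=> [n a] [m b]; rewrite /cover_add /= carryC [n + m]addrC [a + b]addrC.
Qed.

Lemma cover_add0 (A : zmodType) (c : CO A) : left_id (0, 0) (@cover_add A c).
Proof. by move=> [n a]; rewrite /cover_add /= carryC carry0r !add0r addr0. Qed.

Lemma cover_addN (A : zmodType) (c : CO A) :
  left_inverse (0, 0) (@cover_opp A c) (@cover_add A c).
Proof.
move=> [n a]; rewrite /cover_add /= carryC carryNr addNr; congr (_, _); lia.
Qed.

HB.instance Definition _ (A : zmodType) (c : CO A) :=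
  GRing.isZmodule.Build (co_cover c) (@cover_addA A c) (@cover_addC A c)
    (@cover_add0 A c) (@cover_addN A c).

Definition turn (A : zmodType) (c : CO A) : co_cover c := (1, 0).
Definition clift (A : zmodType) (c : CO A) (a : A) : co_cover c := (0, a).

Lemma turnMz (A : zmodType) (c : CO A) (n : int) : turn c *~ n = (n, 0).
Proof.
have nat k : turn c *+ k = (k%:Z, 0).
  elim: k => [|k IH] //; rewrite mulrS IH.
  rewrite /turn -[RHS]/(k.+1%:Z, 0) [LHS]/(cover_add _ _) /cover_add /= carry0r.
  by rewrite !addr0 intS.
case: n => k; first exact: nat.
rewrite NegzE mulrNz -pmulrn nat [LHS]/(cover_opp _) /cover_opp /= oppr0 eqxx.
by rewrite subr0.
Qed.

Lemma cover_split (A : zmodType) (c : CO A) (n : int) (a : A) :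
  (n, a) = turn c *~ n + clift c a.
Proof.
rewrite turnMz [RHS]/(cover_add _ _) /cover_add /= carryC carry0r.
by rewrite !addr0 add0r.
Qed.

Lemma cliftD (A : zmodType) (c : CO A) (a b : A) :
  clift c a + clift c b = turn c *~ carry c a b + clift c (a + b).
Proof. by rewrite -cover_split [LHS]/(cover_add _ _) /cover_add /= add0r. Qed.

Lemma clift0 (A : zmodType) (c : CO A) : clift c 0 = 0.
Proof. by []. Qed.

(** Every [clift c a] lies between 0 and one full turn, so the number of turns decides the sign. *)
Definition cover_nonneg (A : zmodType) (c : CO A) (x : co_cover c) : Prop := 0 <= x.1.

(** Sums stay nonnegative because a carry is 0 or 1; the opposite of [(n, a)] has [- n] turns if
    [a = 0] and [- n - 1] otherwise. *)
Lemma cover_order_cone (A : zmodType) (c : CO A) : order_cone (@cover_nonneg A c).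
Proof.
rewrite /cover_nonneg; split=> [[n a] [m b]|[n a]|[n a]] /=.
- by move=> n0 m0; rewrite !addr_ge0.
- have [n0|n0] := leP 0 n; [by left|right].
  by change (0 <= - n - (a != 0 : int)); case: (a != 0); lia.
- change (0 <= n -> 0 <= - n - (a != 0 : int) -> (n, a) = (0, 0)).
  by have [->|a0] := eqVneq a 0 => /= n0 nn0; [congr (_, _)|]; lia.
Qed.

(** * Orientation on the circle *)

Lemma circle_piD (R : realType) (t u : R) :
  circle_pi (t + u) = circle_pi t + circle_pi u.
Proof. exact: (raddfD (\pi_{ideal_quot (integers R)})%qT). Qed.

Lemma circle_piP (R : realType) (t u : R) :
  circle_pi t = circle_pi u <-> exists n : int, t = u + n%:~R.
Proof.
rewrite /circle_pi; split.
  move/eqP; rewrite -Quotient.idealrBE => /intrP[n tu].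
  by exists n; rewrite -tu subrKC.
move=> [n ->]; apply/eqP; rewrite -Quotient.idealrBE addrAC subrr add0r.
exact: intr_int.
Qed.

Lemma circle_pi_surj (R : realType) (x : circle R) :
  exists t : R, [/\ 0 <= t, t < 1 & circle_pi t = x].
Proof.
have : circle_pi (repr (x : {ideal_quot (integers R)})) = x by apply: reprK.
move: (repr _) => t <-; have /andP[fl lf] := floor_itv t; rewrite intrD in lf.
exists (t - (Num.floor t)%:~R); split; [lra|lra|].
by apply/circle_piP; exists (- Num.floor t); rewrite intrN.
Qed.

Lemma negatively_orientedE (R : realType) (x y z : circle R) :
  negatively_oriented x y z <-> positively_oriented x z y.
Proof.
split=> -[t [u [v [<- <- <- [tu uv vt]]]]].
  exists (t - 1), v, u; split=> //; last by rewrite subrK.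
  by apply/circle_piP; exists (-1); rewrite intrN.
exists (t + 1), v, u; split=> //; last by rewrite addrK.
by apply/circle_piP; exists 1.
Qed.

Lemma positively_orientedD (R : realType) (g x y z : circle R) :
  positively_oriented x y z -> positively_oriented (g + x) (g + y) (g + z).
Proof.
move=> [t [u [v [<- <- <- [tu uv vt]]]]]; have [s [_ _ <-]] := circle_pi_surj g.
exists (s + t), (s + u), (s + v); rewrite !circle_piD; split=> //.
by rewrite -addrA !ltrD2l.
Qed.

(* Cyclic orientation, written as a coboundary so that the cocycle condition is
   automatic. *)
Definition orient (R : realType) (t u v : R) : int :=
  sgz (u - t) + sgz (v - u) - sgz (v - t).

Lemma orientP (R : realType) (t u v : R) :
  [/\ (orient t u v == 0) = [|| t == u, u == v | t == v],
      (orient t u v == 1) = [|| t < u < v, u < v < t | v < t < u]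
    & orient t u v \in [:: -1; 0; 1]].
Proof.
rewrite /orient /sgz !subr_eq0 !subr_lt0.
by case: (ltrgtP t u); case: (ltrgtP u v); case: (ltrgtP t v) => //=; lra.
Qed.

Lemma orient_swap23 (R : realType) (t u v : R) : orient t v u = - orient t u v.
Proof. by rewrite /orient -[u - v]opprB sgzN; ring. Qed.

Lemma orient_positive (R : realType) (t u v : R) :
  0 <= t < 1 -> 0 <= u < 1 -> 0 <= v < 1 ->
  orient t u v = 1 <-> positively_oriented (circle_pi t) (circle_pi u) (circle_pi v).
Proof.
move=> /andP[t0 t1] /andP[u0 u1] /andP[v0 v1].
have piD1 (x : R) : circle_pi (x + 1) = circle_pi x by apply/circle_piP; exists 1.
split.
  move=> /eqP; have [_ -> _] := orientP t u v => /or3P[]/andP[h1 h2].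
  - by exists t, u, v; split=> //; split=> //; lra.
  - by exists t, (u + 1), (v + 1); rewrite !piD1; split=> //; split; lra.
  - by exists t, u, (v + 1); rewrite !piD1; split=> //; split; lra.
move=> [t' [u' [v' [/circle_piP[n ->] /circle_piP[m ->] /circle_piP[k ->]]]]].
move=> [tu uv vt].
have between (i j : int) : i%:~R - j%:~R < 2%:R :> R -> -1 < i%:~R - j%:~R :> R ->
    i = j \/ i = j + 1.
  rewrite -intrB => h1 h2.
  have h3 : (i - j)%:~R < 2%:~R :> R by [].
  have h4 : (-1)%:~R < (i - j)%:~R :> R by rewrite intrN.
  rewrite !ltr_int in h3 h4; lia.
(* The three lifts lie within one turn, so each step raises the integer part by 0 or 1. Raising
   twice is impossible; the other cases are the three cyclic rotations of [t < u < v]. *)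
have mn : m = n \/ m = n + 1 by apply: between; lra.
have km : k = m \/ k = m + 1 by apply: between; lra.
apply/eqP; have [_ -> _] := orientP t u v.
case: mn km tu uv vt => -> [] ->; rewrite ?intrD => tu uv vt.
- by apply/or3P; constructor 1; apply/andP; split; lra.
- by apply/or3P; constructor 3; apply/andP; split; lra.
- by apply/or3P; constructor 2; apply/andP; split; lra.
- exfalso; lra.
Qed.

Definition induces (R : realType) (A : zmodType) (rho : A -> circle R)
    (c : ternary A) : Prop :=
  forall a b d : A,
    [/\ c (a, b, d) = 1 :> int <-> positively_oriented (rho a) (rho b) (rho d),
        c (a, b, d) = -1 :> int <-> negatively_oriented (rho a) (rho b) (rho d)
      & c (a, b, d) = 0 :> int <-> degenerate (rho a) (rho b) (rho d)].

Lemma sign3_eq (s s' : sign3) : (s = 1 :> int <-> s' = 1 :> int) ->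
  (s = -1 :> int <-> s' = -1 :> int) -> s = s' :> int.
Proof.
move=> [h1 h2] [h3 h4].
by case: (sign3P s) (sign3P s') h1 h2 h3 h4 => -> [] -> // *; lia.
Qed.

(** The order is [orient] on representatives in [0, 1), for which the cocycle condition is
    immediate. Left invariance is not visible on representatives; it comes from the invariance of
    orientation under rotation. *)
Lemma induced_order (R : realType) (A : zmodType) (rho : {additive A -> circle R}) :
  injective rho -> exists c : ternary A, CO A c /\ induces rho c.
Proof.
move=> rho_inj.
have [arg argP] := choice (@circle_pi_surj R).
have arg01 x : 0 <= arg x < 1 by have [-> ->] := argP x.
have piK x : circle_pi (arg x) = x by have [] := argP x.
have argI : injective arg by move=> x y xy; rewrite -[x]piK xy piK.
pose o (t : A * A * A) := orient (arg (rho t.1.1)) (arg (rho t.1.2)) (arg (rho t.2)).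
have oM t : o t \in [:: -1; 0; 1] 
  by have [] := orientP (arg (rho t.1.1)) (arg (rho t.1.2)) (arg (rho t.2)).
pose c : ternary A := fun t => SeqSub (oM t).
have cE a b d : (c (a, b, d) : int) =
  orient (arg (rho a)) (arg (rho b)) (arg (rho d)) by [].
have ind : induces rho c.
  move=> a b d; rewrite cE; split.
  - by rewrite orient_positive // !piK.
  - rewrite negatively_orientedE -[rho a]piK -[rho b]piK -[rho d]piK.
    by rewrite -orient_positive // orient_swap23 !piK; split; lia.
  - split=> [/eqP|deg].
      have [-> _ _] := orientP (arg (rho a)) (arg (rho b)) (arg (rho d)).
      by rewrite !(inj_eq argI) => /or3P[] /eqP; rewrite /degenerate; auto.
    apply/eqP; have [-> _ _] := orientP (arg (rho a)) (arg (rho b)) (arg (rho d)).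
    by rewrite !(inj_eq argI); apply/or3P; case: deg => [|[]] ->;
      [constructor 1|constructor 2|constructor 3].
exists c; split=> //; split.
- move=> x y z; have [_ _ cdeg] := ind x y z; rewrite cdeg /degenerate.
  by split=> -[|[]]; [move/rho_inj|move/rho_inj|move/rho_inj|move=> ->..]; auto.
- by move=> g0 g1 g2 g3; rewrite !cE /orient; ring.
- have posD g x y z : positively_oriented (rho (g + x)) (rho (g + y)) (rho (g + z)) <->
      positively_oriented (rho x) (rho y) (rho z).
    split=> [/(positively_orientedD (rho (- g)))|/(positively_orientedD (rho g))].
      by rewrite -!raddfD !addKr.
    by rewrite -!raddfD.
  move=> g x y z; apply: sign3_eq.
    have [gpos _ _] := ind (g + x) (g + y) (g + z); have [xpos _ _] := ind x y z.
    by rewrite gpos xpos.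
  have [_ gneg _] := ind (g + x) (g + y) (g + z); have [_ xneg _] := ind x y z.
  by rewrite gneg xneg !negatively_orientedE; apply: posD.
Qed.

(** * Approximation by rotation orders *)

(** The sets that contain all maps agreeing with [c] on some finite list form a filter [F]. It
    converges to [c] because it does so at each coordinate, hence contains every open set around
    [c]. *)
Lemma open_ternary (A : zmodType) (U : set (ternary A)) (c : ternary A) :
  open U -> U c ->
  exists L : seq (A * A * A), forall c' : ternary A,
    (forall t, t \in L -> c' t = c t) -> U c'.
Proof.
move=> oU Uc.
pose F : set_system (ternary A) := [set V | exists L : seq (A * A * A),
  forall c' : ternary A, (forall t, t \in L -> c' t = c t) -> V c'].
have FF : Filter F.
  split.
  - by exists [::].
  - move=> V W [L LV] [M MW]; exists (L ++ M) => c' c'E; split.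
      by apply: LV => t tL; apply: c'E; rewrite mem_cat tL.
    by apply: MW => t tM; apply: c'E; rewrite mem_cat tM orbT.
  - by move=> V W VW [L LV]; exists L => c' /LV /VW.
suff Fc : F --> c by apply: Fc; apply: open_nbhs_nbhs.
apply/cvg_sup => t; apply/cvg_image.
  by apply/seteqP; split=> // s _; exists (fun=> s).
move=> W /= /nbhs_singleton Wc; exists [set c' : ternary A | W (c' t)].
  by exists [:: t] => c' c'E; rewrite /= c'E ?mem_head.
apply/seteqP; split=> [_ [c' Wc' <-] //|s Ws].
by exists (fun=> s).
Qed.

Lemma clift_strict (A : zmodType) (c : CO A) (a : A) :
  a <> 0 -> strict (@cover_nonneg A c) (clift c a).
Proof. by move=> a0; split=> // -[]. Qed.

Lemma clift_opp (A : zmodType) (c : CO A) (a : A) :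
  a <> 0 -> clift c a + clift c (- a) = turn c.
Proof.
move=> /eqP a0; rewrite cliftD carryNr a0 subrr clift0 addr0.
by rewrite mulr1z.
Qed.

(** Going from [x] to [y] and on to [z] does not pass [x] again, so there is no carry. *)
Lemma clift_chain (A : zmodType) (c : CO A) (x y z : A) :
  co c x y z = 1 -> clift c (y - x) + clift c (z - y) = clift c (z - x).
Proof.
have e : y - x + (z - y) = z - x by rewrite addrC subrKA.
rewrite co_diff cliftD e => h.
have -> : carry c (y - x) (z - y) = 0.
  by rewrite /carry e h eqxx !andbF.
by rewrite mulr0z add0r.
Qed.

Lemma cover_countable (A : zmodType) (c : CO A) :
  countable [set: A] -> countable [set: co_cover c].
Proof.
move=> cA; have := @countableX int A setT setT (countableP _) cA.
by rewrite setXTT.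
Qed.

Lemma fg_countable (A : zmodType) : finitely_generated A -> countable [set: A].
Proof.
move=> [m [s sA]].
have -> : [set: A] = range (fun a : {ffun 'I_m -> int} => \sum_(i < m) s`_i *~ a i).
  by apply/seteqP; split=> // x _; have [a ->] := sA x; exists a.
exact: sub_countable (card_image_le _ _) (countableP _).
Qed.

(** The full turn and the lifts of generators suffice: [clift] is additive up to multiples of the
    turn, so the elements whose lift is in the span form a subgroup. *)
Lemma cover_span (A : zmodType) (c : CO A) : finitely_generated A ->
  exists s : seq (co_cover c), forall x, zspan s x.
Proof.
move=> [m [s sA]]; exists (turn c :: [seq clift c a | a <- s]).
set S := _ :: _.
have turnS n : zspan S (turn c *~ n).
  by apply: zspanMz; apply: zspan_mem; rewrite mem_head.
suff liftS : forall a, zspan S (clift c a).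
  by move=> [n a]; rewrite (cover_split c); apply: zspanD.
have liftSD a b : zspan S (clift c a) -> zspan S (clift c b) -> zspan S (clift c (a + b)).
  move=> Sa Sb; have /(canLR (addKr _)) <- := cliftD c a b.
  by apply: zspanD; [rewrite -mulrNz|exact: zspanD].
have liftSN a : zspan S (clift c a) -> zspan S (clift c (- a)).
  have [->|a0] := pselect (a = 0); first by rewrite oppr0.
  move=> Sa; have /(canRL (addKr _)) -> := clift_opp c a0.
  by apply: zspanD; [exact: zspanN|apply: (turnS 1)].
have liftSM a n : zspan S (clift c a) -> zspan S (clift c (a *~ n)).
  move=> Sa; have nat k : zspan S (clift c (a *+ k)).
    by elim: k => [|k IH]; [exact: zspan0|rewrite mulrS; apply: liftSD].
  by case: n => k; [exact: nat|apply: liftSN; exact: nat].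
move=> a; have [n ->] := sA a.
apply: (big_ind (fun b => zspan S (clift c b))) => [|//|i _].
  exact: zspan0.
apply: liftSM; apply: zspan_mem; rewrite inE map_f ?orbT //.
by rewrite mem_nth // size_tuple.
Qed.

Lemma rotation_approximation (R : realType) (A : zmodType) (c : CO A)
    (L : seq (A * A * A)) : finitely_generated A ->
  exists c' : ternary A, CO_rot R A c' /\ forall t, t \in L -> c' t = set_val c t.
Proof.
move=> fgA; have [s sG] := cover_span c fgA.
(* Only lifts of differences within a triple of [L] must become positive; zero differences are
   harmless, since [strict] excludes them. *)
pose diffs (t : A * A * A) :=
  [seq clift c (p - q) | p <- [:: t.1.1; t.1.2; t.2], q <- [:: t.1.1; t.1.2; t.2]].
have [f [fD0 f0 fL]] := @ordered_group_embed R _ _ s (turn c :: flatten (map diffs L))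
  (cover_order_cone c) (cover_countable c (fg_countable fgA)).
have fD x y : f (x + y) = f x + f y by exact: fD0.
have fM x n : f (x *~ n) = f x *~ n by exact: additive_onMz fD0 _.
have turn_gt0 : 0 < f (turn c).
  by apply: fL; [exact: mem_head|exact: sG|split].
pose phi x := f x / f (turn c).
have phiD x y : phi (x + y) = phi x + phi y by rewrite /phi fD mulrDl.
have phiT n : phi (turn c *~ n) = n%:~R.
  by rewrite /phi fM -mulrzl mulfK // gt_eqF.
have phi0 x : phi x = 0 -> x = 0.
  move/eqP; rewrite mulf_eq0 invr_eq0 (gt_eqF turn_gt0) orbF => /eqP; exact: f0.
have phi_gt0 x y z p q : (x, y, z) \in L -> p \in [:: x; y; z] -> q \in [:: x; y; z] ->
    p <> q -> 0 < phi (clift c (p - q)).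
  move=> tL px qx pq; apply: divr_gt0 => //; apply: fL => //.
    rewrite inE; apply/orP; right; apply/flatten_mapP; exists (x, y, z) => //.
    by apply/allpairsP; exists (p, q).
  by apply: clift_strict => /eqP; rewrite subr_eq0 => /eqP.
pose rho0 (a : A) : circle R := circle_pi (phi (clift c a)).
have rho0D a b : rho0 (a + b) = rho0 a + rho0 b.
  rewrite /rho0 -circle_piD -phiD cliftD phiD phiT; apply/circle_piP.
  by exists (- carry c a b); rewrite intrN addrAC subrr add0r.
have rho0B : zmod_morphism rho0.
  by move=> a b; apply: (canRL (addrK _)); rewrite -rho0D subrK.
pose rhoM := GRing.isZmodMorphism.Build A (circle R) rho0 rho0B.
pose rho : {additive A -> circle R} := HB.pack rho0 rhoM.
have rho_inj : injective rho.
  move=> a b /circle_piP[n ab].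
  (* Equality modulo integers means that the two lifts differ by [n] turns; comparing second
     components gives [a = b]. *)
  have : phi (clift c a - (clift c b + turn c *~ n)) = 0.
    apply: (addIr (phi (clift c b + turn c *~ n))).
    by rewrite -phiD subrK phiD phiT ab add0r.
  move/phi0/eqP; rewrite subr_eq0 addrC -cover_split => /eqP.
  by case.
have [c' [COc' ind]] := induced_order rho_inj.
exists c'; split; first by split=> //; exists rho.
have pos x y z : (forall p q, p \in [:: x; y; z] -> q \in [:: x; y; z] -> p <> q ->
    0 < phi (clift c (p - q))) -> co c x y z = 1 ->
    positively_oriented (rho x) (rho y) (rho z).
  move=> gt0 xyz.
  have [xy yz xz] : [/\ x <> y, y <> z & x <> z].
    have nd : co c x y z <> 0 by rewrite xyz.
    by split=> e; apply: nd; apply/co0P; auto.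
  have chain := clift_chain xyz.
  have zx : z - x <> 0 by move=> /eqP; rewrite subr_eq0 => /eqP /esym.
  have := clift_opp c zx; rewrite opprB => opp.
  pose t := phi (clift c x).
  (* The last point comes before [t + 1] because the lifts of [z - x] and [x - z] add up to one
     turn, which [phi] sends to 1. *)
  exists t, (t + phi (clift c (y - x))), (t + phi (clift c (z - x))); split.
  - by [].
  - rewrite circle_piD -[RHS]/(rho0 y) -[X in rho0 X](subrK x) addrC rho0D.
    by rewrite addrC.
  - rewrite circle_piD -[RHS]/(rho0 z) -[X in rho0 X](subrK x) addrC rho0D.
    by rewrite addrC.
  - have h1 : 0 < phi (clift c (y - x)).
      by apply: gt0; rewrite ?inE ?eqxx ?orbT //; apply: nesym.
    have h2 : 0 < phi (clift c (z - y)).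
      by apply: gt0; rewrite ?inE ?eqxx ?orbT //; apply: nesym.
    have h3 : 0 < phi (clift c (x - z)) by apply: gt0; rewrite ?inE ?eqxx ?orbT.
    have := phiT 1; rewrite mulr1z -opp phiD -chain phiD => h4.
    split; lra.
move=> [[x y] z] tL; apply: val_inj.
change (sign3_int (c' (x, y, z)) = co c x y z).
have [cpos cneg cdeg] := ind x y z.
have [e|e|e] : [\/ co c x y z = -1, co c x y z = 0 | co c x y z = 1] := sign3P _.
(* A negative triple becomes positive when its last two points are exchanged, and its differences
   are the same. *)
- rewrite e; apply/cneg/negatively_orientedE; apply: pos; last by rewrite co_swap23 e.
  move=> p q px qx; apply: (phi_gt0 x y z) => //.
    by move: px; rewrite !inE => /or3P[]->; rewrite ?orbT.
  by move: qx; rewrite !inE => /or3P[]->; rewrite ?orbT.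
- rewrite e; apply/cdeg; move/co0P: e => [->|[->|->]]; rewrite /degenerate; auto.
- by rewrite e; apply/cpos/pos => // p q; apply: phi_gt0.
Qed.

Theorem theorem3p9 (R : realType) (A : zmodType) (hA : finitely_generated A) :
  dense (T := set_type (CO A)) (set_val @^-1` CO_rot R A).
Proof.
move=> O [c Oc] [U oU UO].
have Uc : U (set_val c) by move: Oc; rewrite -UO.
have [L LU] := open_ternary oU Uc.
have [c' [rotc' c'L]] := rotation_approximation R c L hA.
have c'CO : c' \in CO A by apply/mem_set; case: rotc'.
by exists (SigSub c'CO); split=> //; rewrite -UO; apply: LU.
Qed.
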